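(* Let $P$ be a polygon in $\mathbb R^2$ all of whose vertices have algebraic coordinates. If a triangulation of $P$ is an equidissection, then the coordinates of all vertices of this triangulation are algebraic numbers.
   Context: A dissection of a polygon $P\subset\mathbb R^2$ is a partition of $P$ into triangles; it is an equidissection if all its triangles have equal areas. A triangulation of $P$ is a dissection such that no vertex of any triangle lies on the boundary of $P$ except the vertices of $P$, and such that the intersection of any two triangles is either a common edge, a common vertex, or empty. *)

(* Defs.v *)
From mathcomp Require Import all_boot all_order all_algebra.
From mathcomp Require Import all_classical all_reals all_analysis.

Set Implicit Arguments.
Unset Strict Implicit.
Unset Printing Implicit Defensive.

Import Order.TTheory GRing.Theory Num.Theory.
Import numFieldNormedType.Exports.

Local Open Scope classical_set_scope.
Local Open Scope ring_scope.

Section Plane.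
Variable R : realType.
Implicit Types (p q : R * R) (A P : set (R * R)).

Definition algebraic_point p : Prop :=
  algebraicOver (ratr : rat -> R) p.1 /\ algebraicOver (ratr : rat -> R) p.2.

Definition boundary A : set (R * R) := closure A `\` interior A.

Definition segment p q : set (R * R) :=
  [set x | exists2 t : R, 0 <= t <= 1 & x = (1 - t) *: p + t *: q].

(* In a cyclic list of points v, edge i joins v i to its cyclic successor; this
   serves both polygons and triangles. *)
Definition edge n (v : 'I_n -> R * R) (i : 'I_n) : set (R * R) :=
  segment (v i) (v (ordS i)).

Definition simple_closed n (v : 'I_n -> R * R) : Prop :=
  [/\ (3 <= n)%N,
      injective v,
      forall i, edge v i `&` edge v (ordS i) = [set v (ordS i)] &
      forall i j, j != i -> j != ordS i -> i != ordS j ->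
        edge v i `&` edge v j = set0].

(* P is the region enclosed by the simple closed polygonal curve through the
   v i: a bounded closed set with nonempty interior whose topological boundary
   is a Jordan curve is the curve together with its inside.  Convexity is not
   required, and straight angles at the v i are allowed. *)
Definition polygon n (v : 'I_n -> R * R) P : Prop :=
  [/\ simple_closed v,
      closed P,
      bounded_set P,
      interior P !=set0 &
      boundary P = \bigcup_(i in [set: 'I_n]) edge v i].

Definition triangle := 'I_3 -> R * R.

Implicit Types S T : triangle.

Definition region T : set (R * R) :=
  [set x | exists w : 'I_3 -> R,
     [/\ forall i, 0 <= w i, \sum_i w i = 1 & x = \sum_i w i *: T i]].

Definition det2 p q : R := p.1 * q.2 - p.2 * q.1.

Definition area T : R :=
  `| det2 (T (inord 1) - T (inord 0)) (T (inord 2) - T (inord 0)) | / 2.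

Definition nondegenerate T : Prop := area T != 0.

Definition dissection P m (D : 'I_m -> triangle) : Prop :=
  [/\ forall k, nondegenerate (D k),
      \bigcup_(k in [set: 'I_m]) region (D k) = P &
      forall k l, k != l ->
        interior (region (D k)) `&` interior (region (D l)) = set0].

Definition equidissection P m (D : 'I_m -> triangle) : Prop :=
  dissection P D /\ forall k l, area (D k) = area (D l).

Definition meet_in_common_edge S T : Prop :=
  exists i j, edge S i = edge T j /\ region S `&` region T = edge S i.

Definition meet_in_common_vertex S T : Prop :=
  exists i j, S i = T j /\ region S `&` region T = [set S i].

Definition triangulation n (v : 'I_n -> R * R) P m (D : 'I_m -> triangle) :
    Prop :=
  [/\ dissection P D,
      forall k i, boundary P (D k i) -> exists j, D k i = v j &
      forall k l, k != l ->
        [\/ meet_in_common_edge (D k) (D l),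
            meet_in_common_vertex (D k) (D l) |
            region (D k) `&` region (D l) = set0]].

End Plane.

(* Main.v *)
Require Import Defs.
From mathcomp Require Import all_boot all_order all_algebra.
From mathcomp Require Import all_classical all_reals all_analysis.
From mathcomp Require Import ring lra zify.

(** Orient the triangles counterclockwise.  Then every directed edge either is
    the reverse of an edge of exactly one other triangle, or lies on the
    boundary of [P] and has algebraic endpoints.  Summing the shoelace formula
    over all triangles, shared edges cancel, so the common area is algebraic.

    If some coordinate were transcendental, there would be a valuation ring [O]
    of the reals containing the algebraic numbers but not that coordinate.  Let
    [t] be the dominant coordinate difference along an edge, say that of [x]
    along an edge [e].  If [t] is not in [O], rescale to [X = x / t] and
    [Y = t * y'], where [y'] is [y] sheared so as to be constant along [e], and
    let [C] be the set of triangles on which [Y] is integral.  Areas being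
    integral, [C] can be continued across every edge whose [X]-difference is a
    unit, so modulo the maximal ideal the edges bounding [C] contribute nothing
    to the shoelace sum: the area of [C] is a nonunit.  But it is a nonzero
    algebraic number, a contradiction.  If [t] is in [O], then all edges are
    integral and the triangles near an unbounded vertex form a family without
    boundary, whose total area would be [0]. *)

Set Implicit Arguments.
Unset Strict Implicit.
Unset Printing Implicit Defensive.

Import Order.TTheory GRing.Theory Num.Theory.
Import numFieldNormedType.Exports.

Local Open Scope classical_set_scope.
Local Open Scope ring_scope.

(** * Valuation rings *)

Section ValuationRings.
Variable K : fieldType.
Implicit Types (x y z : K) (B O : set K) (p q : {poly K}).

Definition subring B : Prop :=
  [/\ B 1, forall x y, B x -> B y -> B (x - y) &
      forall x y, B x -> B y -> B (x * y)].

Definition valuation_ring O : Prop :=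
  subring O /\ forall x, O x \/ O x^-1.

(* The case [x = 0] is separate because [0^-1 = 0] lies in [O]. *)
Definition nonunit O x : Prop := x = 0 \/ ~ O x^-1.

Definition adjoin B x : set K :=
  [set y | exists2 p : {poly K}, forall i, B p`_i & y = p.[x]].

Section Subring.
Variable B : set K.
Hypothesis ringB : subring B.

Lemma subring1 : B 1. Proof. by case: ringB. Qed.

Lemma subringB x y : B x -> B y -> B (x - y).
Proof. by case: ringB => _ + _; apply. Qed.

Lemma subringM x y : B x -> B y -> B (x * y).
Proof. by case: ringB => _ _; apply. Qed.

Lemma subring0 : B 0.
Proof. by rewrite -(subrr 1); apply: subringB; exact: subring1. Qed.

Lemma subringN x : B x -> B (- x).
Proof. by move=> Bx; rewrite -sub0r; apply: subringB => //; exact: subring0. Qed.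

Lemma subringD x y : B x -> B y -> B (x + y).
Proof. by move=> Bx By; rewrite -[y]opprK; apply/subringB/subringN. Qed.

Lemma subring_sum (I : Type) (r : seq I) (P : pred I) (F : I -> K) :
  (forall i, P i -> B (F i)) -> B (\sum_(i <- r | P i) F i).
Proof.
by move=> BF; apply: big_ind => //; [exact: subring0|exact: subringD].
Qed.

Lemma subringX x n : B x -> B (x ^+ n).
Proof.
move=> Bx; elim: n => [|n IHn]; first exact: subring1.
by rewrite exprS; exact: subringM.
Qed.

Lemma adjoin_subring x : subring (adjoin B x).
Proof.
split.
- exists 1; rewrite ?hornerE // => i; rewrite coef1.
  by case: (i == 0%N); [exact: subring1|exact: subring0].
- move=> _ _ [p Bp ->] [q Bq ->]; exists (p - q); rewrite ?hornerE // => i.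
  by rewrite coefB; exact: subringB.
- move=> _ _ [p Bp ->] [q Bq ->]; exists (p * q); rewrite ?hornerE // => i.
  by rewrite coefM; apply: subring_sum => j _; exact: subringM.
Qed.

Lemma sub_adjoin x : B `<=` adjoin B x.
Proof.
move=> b Bb; exists b%:P; rewrite ?hornerE // => i; rewrite coefC.
by case: (i == 0%N) => //; exact: subring0.
Qed.

Lemma mem_adjoin x : adjoin B x x.
Proof.
exists 'X; rewrite ?hornerE // => i; rewrite coefX.
by case: (i == 1%N); [exact: subring1|exact: subring0].
Qed.

End Subring.

(** * Subrings maximal among those avoiding an element (Chevalley's theorem) *)

Section MaximalSubring.
Variables (B : set K) (z : K).
Hypotheses (ringB : subring B) (Bzi : B z^-1) (Bz : ~ B z).
Hypothesis maxB : forall B', B `<=` B' -> subring B' -> ~ B' z -> B' = B.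

Let z_neq0 : z != 0.
Proof. by apply/eqP => z0; apply: Bz; rewrite z0; exact: subring0. Qed.

Lemma maximal_adjoin x : ~ B x -> adjoin B x z.
Proof.
move=> Bx; apply: contrapT => Bxz; apply: Bx.
rewrite -(maxB (@sub_adjoin _ ringB x) (adjoin_subring ringB x) Bxz).
exact: mem_adjoin.
Qed.

(** If [w] had no inverse in [B], then [z] would be a polynomial in [w^-1], so [z * w ^+ N] would
    lie in [B] for large [N]. But [z * w ^+ n] is congruent to [z] modulo [B] for every [n]. *)
Lemma maximal_inv_1sub b : B b -> B (1 - z^-1 * b)^-1.
Proof.
move=> Bb; set w := 1 - z^-1 * b; apply: contrapT => Bw.
have w0 : w != 0.
  by apply/eqP => w0; apply: Bw; rewrite w0 invr0; exact: subring0.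
have Bw' : B w.
  by apply: subringB => //; [exact: subring1|exact: subringM].
have [p Bp zE] := maximal_adjoin Bw.
have Bzw : B (z * w ^+ size p).
  rewrite zE horner_coef mulr_suml; apply: subring_sum => // i _.
  rewrite -mulrA; apply: subringM => //.
  rewrite exprVn mulrC -expfB_cond; last first.
    by rewrite (negPf w0) add0n ltnW.
  exact: subringX.
have zwB n : B (z - z * w ^+ n).
  elim: n => [|n IHn]; first by rewrite mulr1 subrr; exact: subring0.
  have -> : z - z * w ^+ n.+1 = (z - z * w ^+ n) + b * w ^+ n.
    by rewrite exprS /w; field.
  by apply: subringD => //; apply: subringM => //; exact: subringX.
apply: Bz; rewrite -[z](subrK (z * w ^+ size p)).
exact: subringD.
Qed.

(* One reduction step of Chevalley's theorem: the relation for [x^-1] lowers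
   the degree of the relation for [x]. *)
Lemma maximal_reduce x n p q : x != 0 -> (forall i, B p`_i) ->
    (forall i, B q`_i) -> (size p <= n.+1)%N -> (size q <= n.+1)%N ->
    z = p.[x] -> z = q.[x^-1] ->
  exists r : {poly K}, [/\ forall i, B r`_i, (size r <= n)%N & z = r.[x]].
Proof.
move=> x0 Bp Bq sp sq zp zq; pose w := 1 - z^-1 * q`_0.
have Bw : B w^-1 by exact: maximal_inv_1sub.
have w0 : w != 0.
  apply/eqP => /eqP; rewrite /w subr_eq0 => /eqP e.
  by apply: Bz; rewrite -[z]mulr1 e mulVKf.
(* Multiplying [z = q.[x^-1]] by [x ^+ n] and moving the constant term of [q] to the left gives
   [z * w * x ^+ n] in lower powers of [x]. This eliminates the top term of [p]. *)
pose r := \poly_(i < n) (p`_i + p`_n * z^-1 * w^-1 * q`_(n - i)).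
exists r; split.
- move=> i; rewrite coef_poly; case: ifP => _; last exact: subring0.
  by apply: subringD => //; do !apply: subringM => //.
- exact: size_poly.
rewrite horner_poly.
move: zp; rewrite (horner_coef_wide x sp) big_ord_recr /= => zp.
move: zq; rewrite (horner_coef_wide _ sq) big_ord_recl /= expr0 mulr1.
rewrite (reindex_inj rev_ord_inj) /= => zq.
under eq_bigr do rewrite mulrDl.
rewrite big_split /=.
have -> : \sum_(i < n) p`_n / z / w * q`_(n - i) * x ^+ i =
    p`_n / z / w * x ^+ n * (z - q`_0).
  rewrite [X in (X - _)]zq addrC addKr mulr_sumr; apply: eq_bigr => i _.
  rewrite /bump leq0n add1n subnSK // -!mulrA; congr (_ * (_ * (_ * _))).
  rewrite mulrCA; congr (_ * _).
  rewrite -{2}(subnKC (ltnW (ltn_ord i))) exprD exprVn mulfK //.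
  exact: expf_neq0.
have -> : z - q`_0 = z * w by rewrite /w; field.
rewrite [LHS]zp; congr (_ + _); field.
by rewrite z_neq0 w0.
Qed.

(** Induction on [n + m]: the relation with the larger bound is shortened by the other one,
    exchanging [x] and [x^-1] if necessary. In the end [p] is zero, against [z != 0]. *)
Lemma maximal_no_relations n m x p q : x != 0 -> (forall i, B p`_i) ->
    (forall i, B q`_i) -> (size p <= n)%N -> (size q <= m)%N ->
  z = p.[x] -> z = q.[x^-1] -> False.
Proof.
move eN : (n + m)%N => N.
elim: N n m eN x p q => [|N IHN] n m eN x p q x0 Bp Bq sp sq zp zq.
  have [n0 m0] : n = 0%N /\ m = 0%N by lia.
  move: sp; rewrite n0 leqn0 size_poly_eq0 => /eqP p0.
  by move: z_neq0; rewrite zp p0 horner0 eqxx.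
wlog mn : n m eN x p q x0 Bp Bq sp sq zp zq / (m <= n)%N.
  move=> W; have [mn|nm] := leqP m n; first exact: (W n m eN x p q).
  apply: (W m n _ x^-1 q p) => //; rewrite ?invrK ?invr_eq0 // 1?addnC //.
  exact: ltnW.
case: n => [|n] in eN sp mn *; first by lia.
have [r [Br sr zr]] :=
  maximal_reduce x0 Bp Bq sp (leq_trans sq mn) zp zq.
by apply: (IHN n m _ x r q) => //; lia.
Qed.

(** If neither [x] nor [x^-1] were in [B], both adjunctions would contain [z], giving two relations
    that cannot coexist. *)
Lemma maximal_valuation_ring : valuation_ring B.
Proof.
split=> // x; apply: contrapT => /not_orP[Bx Bxi].
have [p Bp zp] := maximal_adjoin Bx.
have [q Bq zq] := maximal_adjoin Bxi.
apply: (maximal_no_relations _ Bp Bq (leqnn _) (leqnn _) zp zq).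
by apply/eqP => x0; apply: Bx; rewrite x0; exact: subring0.
Qed.

End MaximalSubring.

(** Zorn's lemma, applied to the subrings that contain [B] and avoid [z]. *)
Lemma exists_valuation_ring B z : subring B -> B z^-1 -> ~ B z ->
  exists O, [/\ valuation_ring O, B `<=` O & ~ O z].
Proof.
move=> ringB Bzi Bz.
pose good A := [/\ subring A, B `<=` A & ~ A z].
(* The empty set is admitted because it is the union of the empty chain. *)
pose P A := A = set0 \/ good A.
have [F FP totF|A [PA maxA]] := @Zorn_bigcup K P.
  have [[A FA gA]|nF] := pselect (exists2 A, F A & good A); last first.
    left; apply/seteqP; split => // x [A FA Ax].
    by case: (FP _ FA) => [A0|gA]; [rewrite A0 in Ax|apply: nF; exists A].
  have common x y : (\bigcup_(X in F) X) x -> (\bigcup_(X in F) X) y ->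
      exists X, [/\ F X, good X, X x & X y].
    have mem X t : F X -> X t -> good X.
      by move=> FX Xt; case: (FP _ FX) => // X0; rewrite X0 in Xt.
    move=> [X FX Xx] [Y FY Yy]; case: (totF _ _ FX FY) => sub.
      by exists Y; split => //; [exact: (mem Y y)|exact: sub].
    by exists X; split => //; [exact: (mem X x)|exact: sub].
  right; split; first split.
  - by exists A => //; case: gA => /subring1.
  - move=> x y /common /[apply] -[X [FX [rX _ _] Xx Xy]].
    by exists X => //; exact: subringB.
  - move=> x y /common /[apply] -[X [FX [rX _ _] Xx Xy]].
    by exists X => //; exact: subringM.
  - by move=> x Bx; exists A => //; case: gA => _ + _; apply.
  - by move=> Uz; have [X [_ [_ _ nXz] Xz _]] := common _ _ Uz Uz.
have gA : good A.
  case: PA => // A0; exfalso; apply: (maxA B); last by right; split.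
  by rewrite A0; split => // /(_ 1); apply; exact: subring1.
have [rA BA nAz] := gA; exists A; split => //.
apply: (maximal_valuation_ring rA (BA _ Bzi) nAz) => A' AA' rA' nA'z.
apply/seteqP; split => //; apply: contrapT => A'A.
apply: (maxA A'); first by split.
by right; split => //; exact: subset_trans AA'.
Qed.

(** * Nonunits and divisibility in a valuation ring *)

Section ValuationRing.
Variable O : set K.
Hypothesis valO : valuation_ring O.

Let ringO : subring O. Proof. by case: valO. Qed.

Lemma nonunitMl x y : O x -> nonunit O y -> nonunit O (x * y).
Proof.
move=> Ox; case=> [->|nOy]; first by left; rewrite mulr0.
have [->|x0] := eqVneq x 0; first by left; rewrite mul0r.
right=> Oxy; apply: nOy; have -> : y^-1 = x * (x * y)^-1.
  by rewrite invfM mulVKf.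
exact: subringM.
Qed.

Lemma nonunitMr x y : nonunit O x -> O y -> nonunit O (x * y).
Proof. by move=> Mx Oy; rewrite mulrC; exact: nonunitMl. Qed.

(** One summand divides the other in [O], so the sum is an [O]-multiple of a single summand. *)
Lemma nonunitD x y : nonunit O x -> nonunit O y -> nonunit O (x + y).
Proof.
wlog : x y / O (x / y).
  move=> W Mx My; have [Oxy|Oyx] := valO.2 (x / y); first exact: W.
  by rewrite addrC; apply: W => //; rewrite -invf_div.
move=> Oxy Mx My; have [y0|y0] := eqVneq y 0; first by rewrite y0 addr0.
have -> : x + y = (x / y + 1) * y by field.
by apply: nonunitMl => //; apply: subringD => //; exact: subring1.
Qed.

Lemma nonunit_sum (I : Type) (r : seq I) (P : pred I) (F : I -> K) :
  (forall i, P i -> nonunit O (F i)) ->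
  nonunit O (\sum_(i <- r | P i) F i).
Proof. by move=> MF; apply: big_ind => //; [left|exact: nonunitD]. Qed.

(** Divisibility over [O] is total; the witness is an entry of least valuation. *)
Lemma exists_dominant (s : seq K) : s != [::] ->
  exists2 t, t \in s & forall x, x \in s -> exists2 a, O a & x = a * t.
Proof.
elim: s => // y [|y' s] IHs _.
  exists y; first by rewrite mem_head.
  by move=> x; rewrite inE => /eqP ->; exists 1; [exact: subring1|rewrite mul1r].
have [//|t ts tmax] := IHs.
have [t0|t0] := eqVneq t 0.
  exists y; first by rewrite mem_head.
  move=> x; rewrite inE => /orP[/eqP->|/tmax[a Oa ->]].
    by exists 1; [exact: subring1|rewrite mul1r].
  by exists 0; [exact: subring0|rewrite t0 mulr0 mul0r].
have [Oyt|Oty] := valO.2 (y / t).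
  exists t; first by rewrite inE ts orbT.
  move=> x; rewrite inE => /orP[/eqP->|/tmax//].
  by exists (y / t); rewrite ?divfK.
have [y0|y0] := eqVneq y 0.
  exists t; first by rewrite inE ts orbT.
  move=> x; rewrite inE => /orP[/eqP->|/tmax//].
  by exists 0; [exact: subring0|rewrite mul0r].
exists y; first by rewrite mem_head.
move=> x; rewrite inE => /orP[/eqP->|/tmax[a Oa ->]].
  by exists 1; [exact: subring1|rewrite mul1r].
exists (a * (t / y)); last by rewrite -mulrA divfK.
by apply: subringM => //; rewrite -invf_div.
Qed.

End ValuationRing.

End ValuationRings.

(** The ring to enlarge is obtained by adjoining [z^-1] to the algebraic elements. *)
Lemma algebraic_valuation_ring (F E : fieldType) (FtoE : {rmorphism F -> E})
    (z : E) : ~ algebraicOver FtoE z ->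
  exists O, [/\ valuation_ring O, algebraicOver FtoE `<=` O & ~ O z].
Proof.
move=> nz; have ringA : subring (algebraicOver FtoE).
  by split; [exact: algebraic1|exact: algebraic_sub|exact: algebraic_mul].
have z0 : z != 0 by apply/eqP => z0; apply: nz; rewrite z0; exact: algebraic0.
have [|O [valO sO nOz]] := @exists_valuation_ring _ _ z
    (adjoin_subring ringA z^-1) (mem_adjoin ringA z^-1).
  move=> [p algp zp]; apply: nz; rewrite -[z]invrK; apply: algebraic_inv.
  apply/integral_algebraic.
  (* From [z = p.[z^-1]], the element [z^-1] is a root of ['X * p - 1], which is nonzero since its
     value at 0 is -1. *)
  apply: (@integral_root _ _ _ ('X * p - 1)).
  - apply/eqP => /(congr1 (fun q => q.[0])); rewrite !hornerE => /eqP.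
    by rewrite oppr_eq0 oner_eq0.
  - by rewrite /root !hornerE -zp mulVf // subrr.
  - apply/integral_poly => i; apply/integral_algebraic.
    rewrite coefB coefXM coef1; apply: algebraic_sub.
      by case: ifP => // _; exact: algebraic0.
    by case: (i == 0%N); [exact: algebraic1|exact: algebraic0].
by exists O; split => // x ?; apply: sO; exact: sub_adjoin.
Qed.

(** * Cancellation along shared edges *)

Definition opp_edge (X : Type) (pq : X * X) : X * X := (pq.2, pq.1).

(** Passing to the reverse edge is an involution on the paired edges that negates each term, so the
    sum equals its own negative. *)
Lemma sum_paired (R : numDomainType) (F : finType) (X : eqType)
    (e : F -> X * X) (c : X * X -> R) (C : pred F) :
    injective e -> (forall pq, c (opp_edge pq) = - c pq) ->
  \sum_(f | C f && [exists g, C g && (e g == opp_edge (e f))]) c (e f) = 0.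
Proof.
move=> einj cN; pose D f := C f && [exists g, C g && (e g == opp_edge (e f))].
pose s f := odflt f [pick g | C g && (e g == opp_edge (e f))].
have oppK (pq : X * X) : opp_edge (opp_edge pq) = pq by case: pq.
have sP f : D f -> C (s f) /\ e (s f) = opp_edge (e f).
  move=> /andP[_ /existsP[g gP]]; rewrite /s; case: pickP => [h|/(_ g)].
    by move=> /andP[? /eqP].
  by rewrite gP.
have sD f : D f -> D (s f).
  move=> Df; have [Cs es] := sP f Df; rewrite /D Cs; apply/existsP; exists f.
  by rewrite es oppK eqxx andbT; case/andP: Df.
have ssf f : D f -> s (s f) = f.
  move=> Df; apply: einj; rewrite (sP _ (sD _ Df)).2 (sP _ Df).2.
  exact: oppK.
rewrite -/(\sum_(f | D f) _); set S := \sum_(f | D f) _.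
have SN : S = - S.
  rewrite {1}/S (reindex_onto s s) // -sumrN; apply: eq_big => f.
    apply/andP/idP => [[Ds /eqP ssE]|Df]; last by rewrite ssf // sD.
    by rewrite -ssE; exact: sD.
  move=> /andP[Ds /eqP ssE]; have Df : D f by rewrite -ssE; exact: sD.
  by rewrite (sP _ Df).2 cN.
by have := mulrn_eq0 S 2; rewrite mulr2n {1}SN addNr eqxx => /esym/eqP.
Qed.

(** With [C] selecting the edges of a family of triangles, only the rim of the family survives: the
    edges whose reverse is not in it. *)
Lemma sum_unpaired (R : numDomainType) (F : finType) (X : eqType)
    (e : F -> X * X) (c : X * X -> R) (C : pred F) :
    injective e -> (forall pq, c (opp_edge pq) = - c pq) ->
  \sum_(f | C f) c (e f) =
  \sum_(f | C f && ~~ [exists g, C g && (e g == opp_edge (e f))]) c (e f).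
Proof.
move=> einj cN.
rewrite (bigID (fun f => [exists g, C g && (e g == opp_edge (e f))])) /=.
by rewrite sum_paired // add0r.
Qed.

Lemma I3_ind (P : 'I_3 -> Prop) :
  P (inord 0) -> P (inord 1) -> P (inord 2) -> forall i, P i.
Proof.
move=> P0 P1 P2 [[|[|[|//]]] lti].
- by rewrite (_ : Ordinal _ = inord 0) //; apply: val_inj; rewrite /= inordK.
- by rewrite (_ : Ordinal _ = inord 1) //; apply: val_inj; rewrite /= inordK.
- by rewrite (_ : Ordinal _ = inord 2) //; apply: val_inj; rewrite /= inordK.
Qed.

Lemma ordS3 : [/\ ordS (inord 0 : 'I_3) = inord 1,
  ordS (inord 1 : 'I_3) = inord 2 & ordS (inord 2 : 'I_3) = inord 0].
Proof. by split; apply: val_inj; rewrite /= !inordK. Qed.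

Lemma ordSSS (i : 'I_3) : ordS (ordS (ordS i)) = i.
Proof. by apply: val_inj; case: i => [[|[|[|]]]]. Qed.

Lemma I3_ind_from (P : 'I_3 -> Prop) i :
  P i -> P (ordS i) -> P (ordS (ordS i)) -> forall j, P j.
Proof.
have [e0 e1 e2] := ordS3; elim/I3_ind: i.
- by rewrite e0 e1; exact: I3_ind.
- by rewrite e1 e2 => *; exact: I3_ind.
- by rewrite e2 e0 => *; exact: I3_ind.
Qed.

Lemma sum_I3 (V : nmodType) (F : 'I_3 -> V) :
  \sum_i F i = F (inord 0) + F (inord 1) + F (inord 2).
Proof.
rewrite !big_ord_recl big_ord0 addr0 addrA.
by do !congr (_ + _); congr F; apply: val_inj; rewrite /= inordK.
Qed.

(** * Signed areas and the shoelace formula *)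

Section SignedArea.
Variables (R : comNzRingType) (X : Type) (x y : X -> R).
Implicit Types T : 'I_3 -> X.

(** Twice the signed area of the triangle [p q r]. The coordinates are arbitrary functions on
    abstract points, so that they can be rescaled and sheared. *)
Definition cross (p q r : X) : R :=
  (x q - x p) * (y r - y p) - (y q - y p) * (x r - x p).

(* The trapezoid form of the shoelace formula. *)
Definition trapezoid (pq : X * X) : R :=
  (x pq.1 - x pq.2) * (y pq.1 + y pq.2).

Lemma trapezoid_opp pq : trapezoid (opp_edge pq) = - trapezoid pq.
Proof. by case: pq => p q; rewrite /trapezoid /=; ring. Qed.

Lemma cross_rot p q r : cross q r p = cross p q r.
Proof. by rewrite /cross; ring. Qed.

Lemma cross_ordS T i : cross (T i) (T (ordS i)) (T (ordS (ordS i))) =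
  cross (T (inord 0)) (T (inord 1)) (T (inord 2)).
Proof.
have [e0 e1 e2] := ordS3; elim/I3_ind: i.
- by rewrite e0 e1.
- by rewrite e1 e2; exact: cross_rot.
- by rewrite e2 e0; exact/esym/cross_rot.
Qed.

Lemma sum_trapezoid T i0 : \sum_i trapezoid (T i, T (ordS i)) =
  cross (T i0) (T (ordS i0)) (T (ordS (ordS i0))).
Proof.
rewrite cross_ordS sum_I3; have [-> -> ->] := ordS3.
by rewrite /trapezoid /cross /=; ring.
Qed.

End SignedArea.

(** * Closed families of triangles and algebraicity *)

Section EdgePairing.
Variables (R : numFieldType) (X : eqType) (m : nat) (T : 'I_m -> 'I_3 -> X).
Variable bdry : X -> Prop.

Definition directed_edge (f : 'I_m * 'I_3) : X * X :=
  (T f.1 f.2, T f.1 (ordS f.2)).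

(** This and [edge_opp] carry all the geometry of the triangulation into this section; [bdry] will
    stand for being a vertex of the polygon. *)
Hypothesis edge_inj : injective directed_edge.
Hypothesis edge_opp : forall f,
  (exists g, directed_edge g = opp_edge (directed_edge f)) \/
  bdry (directed_edge f).1 /\ bdry (directed_edge f).2.

Notation alg := (algebraicOver (ratr : rat -> R)).

Lemma sum_cross_cluster (x y : X -> R) (A : R) (C : pred 'I_m) :
    (forall k i, cross x y (T k i) (T k (ordS i)) (T k (ordS (ordS i))) = A) ->
  #|C|%:R * A =
  \sum_(f | C f.1 && ~~ [exists g, C g.1 &&
              (directed_edge g == opp_edge (directed_edge f))])
    trapezoid x y (directed_edge f).
Proof.
move=> crossA.
rewrite -(sum_unpaired (fun f => C f.1) edge_inj (trapezoid_opp x y)).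
transitivity (\sum_(k | C k) \sum_i trapezoid x y (directed_edge (k, i))).
  under eq_bigr do rewrite (sum_trapezoid x y (T _) ord0) crossA.
  by rewrite sumr_const mulr_natl.
by rewrite pair_big_dep /=; apply: eq_big => [[k i]|[k i] //]; rewrite /= andbT.
Qed.

Section Coordinates.
Variables (x y : X -> R) (A : R).
Hypothesis crossA : forall k i,
  cross x y (T k i) (T k (ordS i)) (T k (ordS (ordS i))) = A.
Hypothesis alg_bdry : forall p, bdry p -> alg (x p) /\ alg (y p).

(** The rim of the family of all triangles has algebraic endpoints, so [m%:R * A] is algebraic. *)
Lemma cross_algebraic (k : 'I_m) : alg A.
Proof.
have := sum_cross_cluster predT crossA; rewrite card_ord => mA.
have m0 : m%:R != 0 :> R by rewrite pnatr_eq0; case: (m) k => // -[].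
rewrite -[A](mulKf m0); apply: algebraic_mul.
  by rewrite -ratr_nat -fmorphV; exact: algebraic_id.
rewrite mA; apply: big_ind => [||f]; first exact: algebraic0.
  exact: algebraic_add.
move=> /andP[_ /negP nopp]; case: (edge_opp f) => [[g /eqP eg]|[bp bq]].
  by case: nopp; apply/existsP; exists g.
have [xp yp] := alg_bdry bp; have [xq yq] := alg_bdry bq.
by apply: algebraic_mul; [exact: algebraic_sub|exact: algebraic_add].
Qed.

Section Place.
Variable O : set R.
Hypotheses (valO : valuation_ring O) (algO : alg `<=` O).
Hypothesis A_neq0 : A != 0.

Let ringO : subring O. Proof. by case: valO. Qed.

Let xdiff f := x (directed_edge f).2 - x (directed_edge f).1.
Let ydiff f := y (directed_edge f).2 - y (directed_edge f).1.

(** A nonzero algebraic number has its inverse in [O]. Both cases below end by contradicting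
    this. *)
Let natA_unit (C : pred 'I_m) k : C k -> ~ nonunit O (#|C|%:R * A).
Proof.
move=> Ck; have CA0 : #|C|%:R * A != 0.
  rewrite mulf_neq0 // pnatr_eq0 -lt0n; apply/card_gt0P.
  by exists k.
case=> [/eqP|]; first by rewrite (negPf CA0).
apply; apply: algO; apply: algebraic_inv; apply: algebraic_mul.
  by rewrite -ratr_nat; exact: algebraic_id.
exact: cross_algebraic k.
Qed.

(** Let [C] consist of the triangles whose vertices differ from the nonintegral vertex [o] by
    integral amounts. As edges are integral, [C] contains every triangle that shares a vertex with
    it; a rim edge would have an algebraic endpoint near [o], making [o] integral. So the rim is
    empty and the total area is 0. *)
Lemma bounded_edges_bounded :
    (forall f, O (xdiff f) /\ O (ydiff f)) ->
  forall k i, O (x (T k i)) /\ O (y (T k i)).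
Proof.
move=> Odiff k0 i0; apply: contrapT => nO; pose o := T k0 i0.
pose near p := O (x p - x o) /\ O (y p - y o).
pose C k := `[< forall i, near (T k i) >].
have near_trans p q : near p -> O (x q - x p) -> O (y q - y p) -> near q.
  move=> [px py] qx qy; split.
    by rewrite -(subrK (x p) (x q)) -addrA; exact: subringD.
  by rewrite -(subrK (y p) (y q)) -addrA; exact: subringD.
have memC k i : near (T k i) -> C k.
  move=> nki; apply/asboolP.
  have n1 : near (T k (ordS i)).
    by apply: (near_trans _ _ nki); case: (Odiff (k, i)).
  have n2 : near (T k (ordS (ordS i))).
    by apply: (near_trans _ _ n1); case: (Odiff (k, ordS i)).
  exact: (@I3_ind_from (fun j => near (T k j)) i).
have Ck0 : C k0.
  by apply: (memC k0 i0); rewrite /near !subrr; split; exact: subring0.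
apply: (natA_unit Ck0).
rewrite (sum_cross_cluster C crossA); left; apply: big1 => f.
move=> /andP[/asboolP Cf /negP[]]; case: (edge_opp f) => [[g eg]|[bp _]].
  apply/existsP; exists g; rewrite eg eqxx andbT; apply: (memC g.1 g.2).
  by case: eg => -> _; exact: Cf.
have [nx ny] : near (T f.1 f.2) by exact: Cf.
have [/algO Ox /algO Oy] := alg_bdry bp.
case: nO; split; rewrite -/o.
  by rewrite -[x o](subKr (x (T f.1 f.2))); exact: subringB.
by rewrite -[y o](subKr (y (T f.1 f.2))); exact: subringB.
Qed.

(** In the coordinates [X'], [Y] each rim edge of [C] has integral [Y] at its ends and a nonunit
    [X']-difference, so its trapezoid term is a nonunit. *)
Lemma no_unbounded_dominant_edge f0 : ~ O (xdiff f0) ->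
    (forall f, exists2 a, O a & xdiff f = a * xdiff f0) ->
    (forall f, exists2 a, O a & ydiff f = a * xdiff f0) -> False.
Proof.
set t := xdiff f0 => nOt domx domy.
have t0 : t != 0 by apply/eqP => t0; apply: nOt; rewrite t0; exact: subring0.
have Mt : nonunit O t^-1 by right; rewrite invrK.
pose o := (directed_edge f0).1.
(* The factors [t^-1] and [t] cancel in areas, and the shear makes [Y] vanish at both ends of
   [f0]. *)
pose X' p := x p / t; pose Y p := t * (y p - y o - ydiff f0 / t * (x p - x o)).
have crossXY k i :
    cross X' Y (T k i) (T k (ordS i)) (T k (ordS (ordS i))) = A.
  by rewrite -(crossA k i) /cross /X' /Y; field.
have OX f : O (X' (directed_edge f).2 - X' (directed_edge f).1).
  have [a Oa aE] := domx f; rewrite /X' -mulrBl -/(xdiff f) aE mulfK //.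
pose C k := `[< forall i, O (Y (T k i)) >].
(* [Y] is 0 at both ends of [f0] and [X'] grows by 1 between them, so the area equation gives
   [Y = A] at the third vertex. *)
have Ck0 : C f0.1.
  have Yo : Y (T f0.1 f0.2) = 0.
    by rewrite /Y /o /= !subrr mulr0 subrr mulr0.
  have Yo' : Y (T f0.1 (ordS f0.2)) = 0.
    rewrite /Y -/((directed_edge f0).2) -/(xdiff f0) -/(ydiff f0) -/t.
    by rewrite divfK // subrr mulr0.
  have X1 : X' (T f0.1 (ordS f0.2)) - X' (T f0.1 f0.2) = 1.
    by rewrite /X' -mulrBl divff.
  apply/asboolP; apply: (@I3_ind_from (fun j => O (Y (T f0.1 j))) f0.2).
  - by rewrite Yo; exact: subring0.
  - by rewrite Yo'; exact: subring0.
  have := crossXY f0.1 f0.2; rewrite /cross Yo Yo' X1 !subr0 mul1r mul0r subr0.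
  by move=> ->; apply: algO; exact: cross_algebraic f0.1.
apply: (natA_unit Ck0); rewrite (sum_cross_cluster C crossXY).
apply: nonunit_sum => // f /andP[/asboolP Cf /negP nopp].
rewrite /trapezoid; apply: nonunitMr => //; last by apply: subringD => //; exact: Cf.
case: (edge_opp f) => [[g eg]|[bp bq]]; last first.
  (* Between algebraic points the [X']-difference is an integral multiple of the nonunit [t^-1]. *)
  rewrite /X' -mulrBl; apply: nonunitMl => //.
  have [xp _] := alg_bdry bp; have [xq _] := alg_bdry bq.
  by apply: algO; exact: algebraic_sub.
(* If the [X']-difference were a unit, the triangle across the edge would also lie in [C], and the
   edge would not be on the rim. *)
apply: contrapT => /not_orP[/eqP d0 /contrapT Oinv]; apply: nopp.
apply/existsP; exists g; rewrite eg eqxx andbT; case: eg => eq ep.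
apply/asboolP; apply: (@I3_ind_from (fun j => O (Y (T g.1 j))) g.2).
- by rewrite eq; exact: Cf.
- by rewrite ep; exact: Cf.
have := OX (g.1, ordS (ordS g.2)); rewrite /= ordSSS.
have := crossXY g.1 g.2; rewrite /cross ep eq.
set r := T g.1 _; set p := T f.1 f.2 in d0 Oinv *.
set q := T f.1 (ordS f.2) in d0 Oinv * => crossE OXr.
(* The area equation of the triangle across the edge, solved for [Y] at its third vertex. *)
have -> : Y r =
    Y q + (X' p - X' q)^-1 * (A - (Y p - Y q) * (X' q - X' r)).
  by rewrite -crossE; field.
apply: subringD => //; first exact: Cf.
apply: subringM => //; apply: subringB => //.
  by apply: algO; exact: cross_algebraic g.1.
by apply: subringM => //; apply: subringB => //; exact: Cf.
Qed.

End Place.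

End Coordinates.

(** A transcendental coordinate is missing from some valuation ring containing the algebraic
    numbers, whereas [key] puts all coordinates into every such ring. *)
Theorem algebraic_vertices (x y : X -> R) (A : R) : A != 0 ->
    (forall k i, cross x y (T k i) (T k (ordS i)) (T k (ordS (ordS i))) = A) ->
    (forall p, bdry p -> alg (x p) /\ alg (y p)) ->
  forall k i, alg (x (T k i)) /\ alg (y (T k i)).
Proof.
move=> A0 crossA alg_bdry k i.
have key O : valuation_ring O -> alg `<=` O ->
    O (x (T k i)) /\ O (y (T k i)).
  move=> valO algO; have ringO : subring O by case: valO.
  pose xd (f : 'I_m * 'I_3) :=
    x (directed_edge f).2 - x (directed_edge f).1.
  pose yd (f : 'I_m * 'I_3) :=
    y (directed_edge f).2 - y (directed_edge f).1.
  pose s := [seq xd f | f : 'I_m * 'I_3] ++ [seq yd f | f : 'I_m * 'I_3].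
  have xds f : xd f \in s by rewrite mem_cat map_f ?mem_enum.
  have yds f : yd f \in s by rewrite mem_cat orbC map_f ?mem_enum.
  have [|t ts tmax] := exists_dominant valO (s := s).
    by apply/eqP => s0; have := xds (k, i); rewrite s0.
  have [Ot|nOt] := pselect (O t).
    apply: (bounded_edges_bounded crossA alg_bdry valO algO A0) => f.
    have [a Oa aE] := tmax _ (xds f); have [b Ob bE] := tmax _ (yds f).
    by rewrite -/(xd f) -/(yd f) aE bE; split; exact: subringM.
  exfalso; move: ts; rewrite mem_cat => /orP[] /mapP[f0 _ tE].
    rewrite tE in nOt tmax.
    by apply: (no_unbounded_dominant_edge crossA alg_bdry valO algO A0 nOt) => f;
      [exact: (tmax _ (xds f))|exact: (tmax _ (yds f))].
  (* The quarter turn [(x, y) |-> (y, - x)] preserves signed areas. *)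
  rewrite tE in nOt tmax.
  apply: (@no_unbounded_dominant_edge y (fun p => - x p) A _ _
    _ valO algO A0 f0) => //.
  - by move=> k' i'; rewrite -(crossA k' i') /cross; ring.
  - by move=> p /alg_bdry[? ?]; split => //; exact: algebraic_opp.
  - by move=> f; exact: (tmax _ (yds f)).
  - move=> f; have [a Oa aE] := tmax _ (xds f); exists (- a).
      exact: subringN.
    by rewrite mulNr -[a * _]aE /xd; ring.
split; apply: contrapT => /algebraic_valuation_ring[V [valV algV nV]];
  apply: nV.
  by case: (key V valV algV).
by case: (key V valV algV).
Qed.

End EdgePairing.

(** * Plane triangulations *)

Section Triangulations.
Variable R : realType.
Implicit Types (p q r x a d : R * R) (U P : set (R * R)) (T S : triangle R).

Notation turn := (cross (@fst R R) (@snd R R)).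

Definition ccw T : Prop := 0 < turn (T (inord 0)) (T (inord 1)) (T (inord 2)).

Lemma pairD p q : p + q = (p.1 + q.1, p.2 + q.2). Proof. by []. Qed.

Lemma pairZ (k : R) p : k *: p = (k * p.1, k * p.2). Proof. by []. Qed.

Lemma turn_l p q : turn p q p = 0. Proof. by rewrite /cross; ring. Qed.

Lemma turn_r p q : turn p q q = 0. Proof. by rewrite /cross; ring. Qed.

Lemma turn_comb p q a d (k l : R) : k + l = 1 ->
  turn p q (k *: a + l *: d) = k * turn p q a + l * turn p q d.
Proof.
move=> kl; have -> : l = 1 - k by rewrite -kl; ring.
by rewrite !pairZ !pairD /cross /=; ring.
Qed.

Lemma ccwE T i :
  ccw T -> 0 < turn (T i) (T (ordS i)) (T (ordS (ordS i))).
Proof. by rewrite cross_ordS. Qed.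

(** The barycentric coordinate of [x] at a vertex is the signed area that [x] spans with the
    opposite edge, divided by that of the triangle. *)
Lemma region_ccwP T x : ccw T ->
  region T x <-> forall i, 0 <= turn (T i) (T (ordS i)) x.
Proof.
move=> cT; have [e0 e1 e2] := ordS3.
move: (cT); rewrite /ccw /region.
set a := T (inord 0); set b := T (inord 1); set c := T (inord 2) => abc.
have D0 : turn a b c != 0 by rewrite gt_eqF.
split => [[w [w0 w1 xE]]|turn0].
  have ww i : 0 <= w i * turn a b c by rewrite mulr_ge0 // ltW.
  move: w1 xE; rewrite !sum_I3 -/a -/b -/c => w1 xE.
  have w0E : w (inord 0) = 1 - w (inord 1) - w (inord 2) by rewrite -w1; ring.
  elim/I3_ind; rewrite ?e0 ?e1 ?e2 -/a -/b -/c.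
  - suff -> : turn a b x = w (inord 2) * turn a b c by exact: ww.
    by rewrite xE w0E !pairZ !pairD /cross /=; ring.
  - suff -> : turn b c x = w (inord 0) * turn a b c by exact: ww.
    by rewrite xE w0E !pairZ !pairD /cross /=; ring.
  - suff -> : turn c a x = w (inord 1) * turn a b c by exact: ww.
    by rewrite xE w0E !pairZ !pairD /cross /=; ring.
exists (fun i => turn (T (ordS i)) (T (ordS (ordS i))) x / turn a b c); split.
- by move=> i; rewrite divr_ge0 // ltW.
- by rewrite sum_I3 !(e0, e1, e2) -/a -/b -/c /cross; field.
- rewrite sum_I3 !(e0, e1, e2) -/a -/b -/c !pairZ !pairD.
  case: x turn0 => x1 x2 _; congr pair; rewrite /=.
    by move: D0; rewrite /cross /= => D0; field.
  by move: D0; rewrite /cross /= => D0; field.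
Qed.

Lemma turn_continuous p q : continuous (turn p q).
Proof.
move=> x; rewrite /cross; apply: cvgB; apply: cvgM; try exact: cvg_cst.
  by apply: cvgB; [exact: cvg_snd|exact: cvg_cst].
by apply: cvgB; [exact: cvg_fst|exact: cvg_cst].
Qed.

Lemma near_turn p q x :
  0 < turn p q x -> \forall y \near x, 0 < turn p q y.
Proof. by move=> h; exact: (@turn_continuous p q x _ (lt_nbhsr h)). Qed.

Lemma region_closed T : ccw T -> closed (region T).
Proof.
move=> cT; have -> : region T =
    \bigcap_(i in [set: 'I_3]) (turn (T i) (T (ordS i)) @^-1` [set t | 0 <= t]).
  apply/seteqP; split => x; first by move=> /(region_ccwP _ cT) ? i _ /=.
  by move=> Tx; apply/(region_ccwP _ cT) => i; exact: (Tx i).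
apply: closed_bigI => i _; apply: preimage_closed; last exact: closed_ge.
by move=> x _; exact: turn_continuous.
Qed.

Lemma interior_region T x : ccw T ->
  (forall i, 0 < turn (T i) (T (ordS i)) x) -> interior (region T) x.
Proof.
move=> cT Tx; rewrite /interior.
have := @filter_forall _ _ _ _ (nbhs_filter x) (fun i => near_turn (Tx i)).
by apply: filterS => y Ty; apply/(region_ccwP _ cT) => i; exact: ltW.
Qed.

Lemma line_near U a d : nbhs a U -> exists2 e : R, 0 < e < 1 & U (a + e *: d).
Proof.
move=> Ua; have Ue : \forall e \near (0 : R)^'+, U (a + e *: d).
  have : (fun e : R => a + e *: d) @ (0 : R)^'+ --> a.
    apply: cvg_at_right_filter.
    rewrite -[X in _ --> X]addr0 -[X in _ + X](scale0r d).
    by apply: cvgD; [exact: cvg_cst|exact: scalel_continuous].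
  by apply.
have [e [[e0 e1] Uae]] := filter_ex
  (filterI (filterI (nbhs_right_gt (0 : R)) (nbhs_right_lt (@ltr01 R))) Ue).
by exists e; rewrite ?e0.
Qed.

Lemma ccw_inj T : ccw T -> injective T.
Proof.
move=> cT i j; have D0 := ccwE i cT; move: j.
apply: (@I3_ind_from (fun j => T i = T j -> i = j) i) => // e; exfalso.
  by move: D0; rewrite -e /cross !subrr !mul0r subrr ltxx.
by move: D0; rewrite -e /cross !subrr !mulr0 subrr ltxx.
Qed.

(* The witness lies close to the midpoint of the shared edge. *)
Lemma ccw_common_edge_overlap S T i j : ccw S -> ccw T ->
    S i = T j -> S (ordS i) = T (ordS j) ->
  interior (region S) `&` interior (region T) !=set0.
Proof.
move=> cS cT eST eST'.
pose a : R * R := 2^-1 *: S i + 2^-1 *: S (ordS i).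
have half : 2^-1 + 2^-1 = 1 :> R by field.
pose mid_near (V : triangle R) k := \forall x \near a,
  0 < turn (V (ordS k)) (V (ordS (ordS k))) x /\
  0 < turn (V (ordS (ordS k))) (V k) x.
have nearP V k : ccw V -> V k = S i -> V (ordS k) = S (ordS i) -> mid_near V k.
  move=> cV e e'; have D1 := ccwE (ordS k) cV.
  have D2 := ccwE (ordS (ordS k)) cV; rewrite ordSSS in D1 D2.
  have h0 : 0 < 2^-1 :> R by rewrite invr_gt0.
  apply: filterI; apply: near_turn; rewrite turn_comb // -e -e'.
  - by rewrite turn_l mulr0 addr0 mulr_gt0.
  - by rewrite turn_r mulr0 add0r mulr_gt0.
(* Both triangles lie to the left of the shared edge, so a small step towards the third vertex of
   [S] enters both. *)
have [e /andP[e0 e1] [[s1 s2] [t1 t2]]] := line_near (S (ordS (ordS i)) - a)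
  (filterI (nearP _ _ cS erefl erefl) (nearP _ _ cT (esym eST) (esym eST'))).
set x := a + _ in s1 s2 t1 t2.
have x0 : 0 < turn (S i) (S (ordS i)) x.
  have -> : x = (1 - e) *: a + e *: S (ordS (ordS i)).
    by rewrite /x scalerBr scalerBl scale1r addrCA addrC addrAC.
  rewrite turn_comb ?subrK // turn_comb // turn_l turn_r !mulr0 addr0.
  by rewrite mulr0 add0r mulr_gt0 // ccwE.
exists x; split; apply: interior_region => //.
  by apply: (@I3_ind_from (fun k => 0 < turn (S k) (S (ordS k)) x) i);
    rewrite ?ordSSS.
by apply: (@I3_ind_from (fun k => 0 < turn (T k) (T (ordS k)) x) j);
  rewrite ?ordSSS // -eST -eST'.
Qed.

Lemma segment_l p q : segment p q p.
Proof. by exists 0; rewrite ?lexx ?ler01 // subr0 scale1r scale0r addr0. Qed.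

Lemma segmentC p q : segment p q = segment q p.
Proof.
by apply/seteqP; split => x [t /andP[t0 t1] ->]; exists (1 - t);
  rewrite ?subr_ge0 ?t1 ?gerBl // subKr addrC.
Qed.

(** The endpoints of each segment have parameters in the unit interval on the other. Composing the
    parametrizations gives [ac] and [ad], which force [a] and [b] to be 0 and 1 in some order. *)
Lemma segment_endpoints p q p' q' : p <> q -> segment p q = segment p' q' ->
  p = p' /\ q = q' \/ p = q' /\ q = p'.
Proof.
move=> pq pqE.
have onE x y (t : R) : (1 - t) *: x + t *: y = x + t *: (y - x) :> R * R.
  by rewrite scalerBl scale1r scalerBr addrAC addrA.
have on x y z : segment x y z ->
    exists2 t : R, 0 <= t <= 1 & z = x + t *: (y - x).
  by move=> [t ? ->]; exists t.
have [|a /andP[a0 a1] pE] := on p' q' p; first by rewrite -pqE; exact: segment_l.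
have [|b /andP[b0 b1] qE] := on p' q' q.
  by rewrite -pqE segmentC; exact: segment_l.
have [|c /andP[c0 c1] p'E] := on p q p'; first by rewrite pqE; exact: segment_l.
have [|d /andP[d0 d1] q'E] := on p q q'.
  by rewrite pqE segmentC; exact: segment_l.
have dn0 : q' - p' != 0.
  by apply/eqP => d00; apply: pq; rewrite pE qE d00 !scaler0.
have qp : q - p = (b - a) *: (q' - p').
  by rewrite qE pE opprD addrACA subrr add0r scalerBl.
have ac : a + c * (b - a) = 0.
  apply/eqP; have := scaler_eq0 (a + c * (b - a)) (q' - p').
  rewrite (negPf dn0) orbF => <-; rewrite scalerDl -scalerA -qp.
  by rewrite -(inj_eq (addrI p')) addrA -pE -p'E addr0.
have ad : a + d * (b - a) = 1.
  apply/eqP; rewrite -subr_eq0.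
  have := scaler_eq0 (a + d * (b - a) - 1) (q' - p').
  rewrite (negPf dn0) orbF => <-; rewrite scalerBl scale1r scalerDl -scalerA.
  by rewrite -qp -(inj_eq (addrI p')) !addrA -pE -q'E addr0 subKr.
have [a00|a00] := eqVneq a 0.
  left; rewrite pE qE a00 scale0r addr0; split => //.
  have -> : b = 1 by move: ad; rewrite a00; nra.
  by rewrite scale1r subrKC.
(* By [ac], [(1 - c) * a + c * b = 0], and both terms are nonnegative. *)
right; have ca : (1 - c) * a = 0 by nra.
have c11 : c = 1.
  by move: ca => /eqP; rewrite mulf_eq0 (negPf a00) orbF subr_eq0 => /eqP.
have b00 : b = 0 by move: ac; rewrite c11; lra.
have a11 : a = 1 by move: ad; rewrite b00; nra.
by rewrite pE qE a11 b00 scale1r scale0r addr0 subrKC.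
Qed.

(** * Shared and unshared edges of a triangulation *)

Section Triangulated.
Variables (n : nat) (v : 'I_n -> R * R) (P : set (R * R)).
Variables (m : nat) (D : 'I_m -> triangle R).
Hypothesis triD : triangulation v P D.
Hypothesis ccwD : forall k, ccw (D k).

Let cover : \bigcup_(k in [set: 'I_m]) region (D k) = P.
Proof. by case: triD => -[]. Qed.

(** Two counterclockwise triangles on the same directed edge lie on the same side of it, so their
    interiors overlap. *)
Lemma directed_edge_inj : injective (directed_edge D).
Proof.
move=> [k i] [l j] [/= ei ej].
have [kl|kl] := eqVneq k l.
  by rewrite -kl in ei *; rewrite (ccw_inj (ccwD k) ei).
have [x] := ccw_common_edge_overlap (ccwD k) (ccwD l) ei ej.
by case: triD => -[_ _ disj] _ _; rewrite (disj _ _ kl).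
Qed.

Section UnsharedEdge.
Variables (k : 'I_m) (i : 'I_3).
Hypothesis unshared : forall l j, k != l -> edge (D l) j <> edge (D k) i.

Let p := D k i.
Let q := D k (ordS i).
Let r := D k (ordS (ordS i)).

(** Otherwise a second triangle contains the point [z]. It meets [D k] in an edge or a vertex, but
    [z] is no vertex and lies on no edge of [D k] except the unshared one. *)
Lemma unshared_not_interior (t : R) : 0 < t < 1 ->
  ~ interior P ((1 - t) *: p + t *: q).
Proof.
move=> /andP[t0 t1] intz; set z := _ + _ in intz.
have D0 : 0 < turn p q r by exact: ccwE.
have pqz : turn p q z = 0.
  by rewrite turn_comb ?subrK // turn_l turn_r !mulr0 addr0.
have qrz : 0 < turn q r z.
  rewrite turn_comb ?subrK // turn_l mulr0 addr0.
  by apply: mulr_gt0; [rewrite subr_gt0|rewrite cross_rot].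
have rpz : 0 < turn r p z.
  rewrite turn_comb ?subrK // turn_r mulr0 add0r.
  by apply: mulr_gt0 => //; rewrite -cross_rot.
pose U := \bigcup_(l in [set l | k != l]) region (D l).
have closedU : closed U.
  by apply: closed_bigcup => [|l _]; [exact: finite_finset|exact: region_closed].
(* If the closed set [U] missed [z], a point slightly beyond the edge, away from [r], would lie in
   [P] but in no triangle. *)
have [l kl Dlz] : U z.
  apply: contrapT => nUz.
  have Uz : nbhs z (~` U).
    by apply: open_nbhs_nbhs; split => //; rewrite openC.
  have [e /andP[e0 e1] [nUe]] := line_near (z - r) (filterI Uz intz).
  rewrite -cover => -[l _ Dl].
  have [kl|kl] := eqVneq k l; last by apply: nUe; exists l.
  move: Dl; rewrite -kl => /(region_ccwP _ (ccwD k))/(_ i).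
  rewrite -/p -/q leNgt => /negP; apply.
  have -> : z + e *: (z - r) = (1 + e) *: z + (- e) *: r.
    by rewrite scalerBr scalerDl scale1r scaleNr addrA.
  by rewrite turn_comb ?addrK // pqz mulr0 add0r mulNr oppr_lt0 mulr_gt0.
have Dkz : region (D k) z.
  apply/(region_ccwP _ (ccwD k)).
  apply: (@I3_ind_from (fun j => 0 <= turn (D k j) (D k (ordS j)) z) i);
    rewrite ?ordSSS -/p -/q -/r ?pqz //; exact: ltW.
case: triD => _ _ /(_ k l kl) [[i' [j [eE IE]]]|[i' [j [_ IE]]]|IE].
- have : edge (D k) i' z by rewrite -IE.
  move: eE; move: i' {IE}.
  apply: (@I3_ind_from (fun i' => edge (D k) i' = edge (D l) j ->
    edge (D k) i' z -> False) i) => eE.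
  + by have := unshared kl (j := j); rewrite eE.
  + rewrite /edge -/q -/r => -[s _ zE]; move: qrz; rewrite zE turn_comb ?subrK //.
    by rewrite turn_l turn_r !mulr0 addr0 ltxx.
  + rewrite /edge ordSSS -/p -/r => -[s _ zE]; move: rpz.
    by rewrite zE turn_comb ?subrK // turn_l turn_r !mulr0 addr0 ltxx.
- have : [set D k i'] z by rewrite -IE.
  move: i' {IE}; apply: (@I3_ind_from (fun i' => z = D k i' -> False) i) => zE.
  + by move: rpz; rewrite zE turn_r ltxx.
  + by move: qrz; rewrite zE turn_l ltxx.
  + by move: qrz; rewrite zE turn_r ltxx.
- by have : set0 z by rewrite -IE.
Qed.

(** An endpoint interior to [P] would have points of the open edge near it that are interior to [P]
    too. *)
Lemma unshared_boundary : boundary P p /\ boundary P q.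
Proof.
have Dk j : closure P (D k j).
  apply: subset_closure; rewrite -cover; exists k => //.
  apply/(region_ccwP _ (ccwD k)).
  apply: (@I3_ind_from (fun j' => 0 <= turn (D k j') (D k (ordS j')) (D k j)) j).
  - by rewrite turn_l.
  - by apply: ltW; rewrite cross_rot; exact: ccwE.
  - by rewrite ordSSS turn_r.
split; split; try exact: Dk.
  move=> /nbhs_interior /(line_near (q - p)) [e e01].
  have -> : p + e *: (q - p) = (1 - e) *: p + e *: q.
    by rewrite scalerBr scalerBl scale1r addrCA addrC.
  exact: unshared_not_interior.
move=> /nbhs_interior /(line_near (p - q)) [e /andP[e0 e1]].
have -> : q + e *: (p - q) = (1 - (1 - e)) *: p + (1 - e) *: q.
  by rewrite subKr scalerBr scalerBl scale1r addrCA.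
by apply: unshared_not_interior; rewrite subr_gt0 e1 gtrBl.
Qed.

End UnsharedEdge.

(** Two triangles cannot traverse a shared edge in the same direction; an unshared edge has its ends
    on the boundary, hence at polygon vertices. *)
Lemma directed_edge_opp f :
  (exists g, directed_edge D g = opp_edge (directed_edge D f)) \/
  (exists j, (directed_edge D f).1 = v j) /\
  (exists j, (directed_edge D f).2 = v j).
Proof.
case: f => k i; have [[l [j [kl eE]]]|nsh] := pselect (exists l j,
    k != l /\ edge (D l) j = edge (D k) i); last first.
  have [|bp bq] := @unshared_boundary k i.
    by move=> l j kl eE; apply: nsh; exists l, j.
  by right; case: triD => _ bd _; split; exact: bd.
left; exists (l, j); rewrite /opp_edge /=.
have pq : D l j <> D l (ordS j).
  by move=> /(ccw_inj (ccwD l))/(congr1 val)/=; case: (j) => -[|[|[]]].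
case: (segment_endpoints pq eE) => [[e1 e2]|[e1 e2]].
  have := @directed_edge_inj (l, j) (k, i); rewrite /directed_edge /= e1 e2.
  by move=> /(_ erefl)[lk]; rewrite lk eqxx in kl.
by rewrite /directed_edge /= e1 e2.
Qed.

End Triangulated.

(** * Counterclockwise reordering of the vertices *)

Definition orient T : triangle R :=
  if 0 < turn (T (inord 0)) (T (inord 1)) (T (inord 2)) then T
  else T \o @rev_ord 3.

Lemma areaE T :
  area T = `|turn (T (inord 0)) (T (inord 1)) (T (inord 2))| / 2.
Proof. by []. Qed.

Lemma turn_orient T : turn (orient T (inord 0)) (orient T (inord 1))
  (orient T (inord 2)) = 2 * area T.
Proof.
rewrite areaE mulrC divfK // /orient.
case: ltP => [h|h]; first by rewrite gtr0_norm.
rewrite /comp.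
have -> : @rev_ord 3 (inord 0) = inord 2.
  by apply: val_inj; rewrite /= !inordK.
have -> : @rev_ord 3 (inord 1) = inord 1.
  by apply: val_inj; rewrite /= !inordK.
have -> : @rev_ord 3 (inord 2) = inord 0.
  by apply: val_inj; rewrite /= !inordK.
by rewrite ler0_norm // /cross; ring.
Qed.

Lemma ccw_orient T : Defs.nondegenerate T -> ccw (orient T).
Proof.
rewrite /Defs.nondegenerate /ccw turn_orient => a0.
by rewrite mulr_gt0 // lt0r a0 areaE divr_ge0.
Qed.

Lemma orient_vertex T i : exists j, orient T i = T j.
Proof. by rewrite /orient; case: ifP => _; [exists i|exists (rev_ord i)]. Qed.

Lemma vertex_orient T i : exists j, orient T j = T i.
Proof.
rewrite /orient; case: ifP => _; [by exists i|exists (rev_ord i)].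
by rewrite /= rev_ordK.
Qed.

Lemma edge_orient T i : exists j, edge (orient T) j = edge T i.
Proof.
(* After the reversal, edge [i] starts at the old vertex [ordS i] and runs backwards. *)
rewrite /orient; case: ifP => _; [by exists i|exists (rev_ord (ordS i))].
rewrite /edge segmentC /= rev_ordK; congr (segment (T _) _).
by apply: val_inj; case: i => -[|[|[]]].
Qed.

Lemma region_orient T : region (orient T) = region T.
Proof.
rewrite /orient; case: ifP => _ //; apply/seteqP; split => x [w [w0 w1 ->]].
  exists (w \o @rev_ord 3); split => [i|//|]; first exact: w0.
    by rewrite -w1 [RHS](reindex_inj rev_ord_inj).
  rewrite [LHS](reindex_inj rev_ord_inj); apply: eq_bigr => i _ /=.
  by rewrite rev_ordK.
exists (w \o @rev_ord 3); split => [i|//|]; first exact: w0.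
  by rewrite -w1 [RHS](reindex_inj rev_ord_inj).
by rewrite [LHS](reindex_inj rev_ord_inj).
Qed.

(** All clauses depend only on regions, areas, vertex sets and undirected edges, which the
    reordering preserves. *)
Lemma triangulation_orient n (v : 'I_n -> R * R) P m (D : 'I_m -> triangle R) :
  triangulation v P D -> triangulation v P (fun k => orient (D k)).
Proof.
move=> [[nd cover disj] bd meet]; split; first split.
- move=> k; rewrite /Defs.nondegenerate areaE mulf_neq0 ?invr_eq0 ?normr_eq0 //.
  by rewrite gt_eqF //; exact: ccw_orient.
- by rewrite -cover; apply: eq_bigcupr => k _; exact: region_orient.
- by move=> k l kl; rewrite !region_orient; exact: disj.
- move=> k i; have [j ->] := orient_vertex (D k) i; exact: bd.
move=> k l /meet[[i [j [eE IE]]]|[i [j [vE IE]]]|IE].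
- have [i' ei] := edge_orient (D k) i; have [j' ej] := edge_orient (D l) j.
  by apply: Or31; exists i', j'; rewrite !region_orient ei ej.
- have [i' ei] := vertex_orient (D k) i; have [j' ej] := vertex_orient (D l) j.
  by apply: Or32; exists i', j'; rewrite !region_orient ei ej.
- by apply: Or33; rewrite !region_orient.
Qed.

End Triangulations.

Theorem theorem2 (R : realType) (n : nat) (v : 'I_n -> R * R) (P : set (R * R))
    (m : nat) (D : 'I_m -> triangle R) :
  polygon v P ->
  (forall i : 'I_n, algebraic_point (v i)) ->
  triangulation v P D ->
  equidissection P D ->
  forall (k : 'I_m) (i : 'I_3), algebraic_point (D k i).
Proof.
move=> _ algv triD [_ areaD] k i.
have triD' := triangulation_orient triD.
have nd l : Defs.nondegenerate (D l) by case: triD => -[].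
have ccwD l : ccw (orient (D l)) by exact: ccw_orient.
have [j <-] := vertex_orient (D k) i.
(* [A] is twice the common area because [cross] is twice the signed area. *)
apply: (algebraic_vertices (bdry := fun p => exists l, p = v l)
  (directed_edge_inj triD' ccwD)
  (directed_edge_opp triD' ccwD) (A := 2 * area (D k))).
- by rewrite mulf_neq0 //; exact: nd.
- by move=> l i'; rewrite cross_ordS turn_orient (areaD l k).
- by move=> _ [l ->]; exact: algv.
Qed.
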